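(* Let $G_1$ and $G_2$ be finite simple graphs with $n_1 = |V(G_1)| \geq 2$, $n_2 = |V(G_2)| \geq 2$, $m_1 = |E(G_1)|$ and $m_2 = |E(G_2)|$. Then $$\tau(G_1 \square G_2) \leq \tau(G_1)\,\tau(G_2) \left[ \frac{2m_1}{n_1-1} + \frac{2m_2}{n_2-1} \right]^{(n_1-1)(n_2-1)},$$ and equality holds if and only if $G_1$ is not connected, or $G_2$ is not connected, or ($G_1 \cong K_{n_1}$ and $G_2 \cong K_{n_2}$).
   Context: For a graph $G$, $\tau(G)$ denotes the number of spanning trees of $G$ (so $\tau(G)=0$ if $G$ is not connected). $K_n$ is the complete graph on $n$ vertices. For simple graphs $G_1, G_2$, the Cartesian product $G_1 \square G_2$ is the graph with vertex set $V(G_1) \times V(G_2)$ in which $(u,u')$ and $(v,v')$ are adjacent if and only if either $u = v$ and $u'v' \in E(G_2)$, or $u' = v'$ and $uv \in E(G_1)$. *)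

(* Defs.v *)
From mathcomp Require Import all_boot.

Set Implicit Arguments.
Unset Strict Implicit.
Unset Printing Implicit Defensive.

Record sgraph := SGraph {
  svertex :> finType;
  sedge : rel svertex;
  sedge_sym : symmetric sedge;
  sedge_irrefl : irreflexive sedge
}.

Definition edges (G : sgraph) : {set {set G}} :=
  [set [set p.1; p.2] | p : G * G & sedge p.1 p.2].

Lemma in_edges (G : sgraph) (x y : G) : ([set x; y] \in edges G) = sedge x y.
Proof.
apply/imsetP/idP => [[[u v]]|exy]; last by exists (x, y) => //; rewrite inE.
rewrite inE /= => euv E.
have ux : u \in [set x; y] by rewrite E !inE eqxx.
have vx : v \in [set x; y] by rewrite E !inE eqxx orbT.
move: ux vx euv; rewrite !inE => /orP[]/eqP-> /orP[]/eqP->;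
  by rewrite ?sedge_irrefl // sedge_sym.
Qed.

Definition connected (G : sgraph) : bool :=
  [forall x : G, forall y : G, connect (@sedge G) x y].

(* A cycle is a duplicate-free cyclic sequence of at least three vertices; the
   length bound #|G| makes the quantification finite and loses nothing, see
   [acyclicP]. *)
Definition acyclic (G : sgraph) : bool :=
  [forall k : 'I_#|G|.+1, forall s : k.-tuple G,
     (2 < k) ==> ~~ ucycleb (@sedge G) s].

Lemma acyclicP (G : sgraph) :
  reflect (forall s : seq G, 2 < size s -> ~ ucycle (@sedge G) s) (acyclic G).
Proof.
apply: (iffP forallP) => [H s s2 us|H k]; last first.
  apply/forallP => s; apply/implyP => k2; apply/negP; apply: H.
  by rewrite size_tuple.
have sk : size s < #|G|.+1.
  by case/andP: (us) => _ /card_uniqP <-; rewrite ltnS max_card.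
have /forallP/(_ (in_tuple s)) := H (Ordinal sk).
by move=> /implyP/(_ s2)/negP; apply.
Qed.

Definition is_tree (G : sgraph) : bool := connected G && acyclic G.

Section SpanningSubgraph.
Variables (V : finType) (F : {set {set V}}).

Definition span_rel : rel V := [rel x y | (x != y) && ([set x; y] \in F)].

Fact span_rel_sym : symmetric span_rel.
Proof. by move=> x y; rewrite /span_rel /= eq_sym setUC. Qed.

Fact span_rel_irrefl : irreflexive span_rel.
Proof. by move=> x; rewrite /span_rel /= eqxx. Qed.

Definition span_graph : sgraph := SGraph span_rel_sym span_rel_irrefl.

End SpanningSubgraph.

(* A spanning tree is identified with its edge set. *)
Definition spanning_trees (G : sgraph) : {set {set {set G}}} :=
  [set F : {set {set G}} | (F \subset edges G) && is_tree (span_graph F)].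

Definition tau (G : sgraph) : nat := #|spanning_trees G|.

Section Complete.
Variable n : nat.

Definition complete_rel : rel 'I_n := [rel x y | x != y].

Fact complete_rel_sym : symmetric complete_rel.
Proof. by move=> x y; rewrite /complete_rel /= eq_sym. Qed.

Fact complete_rel_irrefl : irreflexive complete_rel.
Proof. by move=> x; rewrite /complete_rel /= eqxx. Qed.

Definition complete_graph : sgraph :=
  SGraph complete_rel_sym complete_rel_irrefl.

End Complete.

Section CartesianProduct.
Variables G1 G2 : sgraph.

Definition cart_rel : rel (G1 * G2) :=
  [rel u v | ((u.1 == v.1) && sedge u.2 v.2)
             || ((u.2 == v.2) && sedge u.1 v.1)].

Fact cart_rel_sym : symmetric cart_rel.
Proof.
by move=> u v; rewrite /cart_rel /= (eq_sym u.1) (eq_sym u.2) (sedge_sym u.1)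
  (sedge_sym u.2). Qed.

Fact cart_rel_irrefl : irreflexive cart_rel.
Proof. by move=> u; rewrite /cart_rel /= !sedge_irrefl !andbF. Qed.

Definition cart_prod : sgraph := SGraph cart_rel_sym cart_rel_irrefl.

End CartesianProduct.

Definition sg_iso (G H : sgraph) : Prop :=
  exists2 f : G -> H, bijective f & forall x y, sedge (f x) (f y) = sedge x y.

(* Main.v *)
Require Import Defs.
From mathcomp Require Import all_boot all_order all_fingroup all_algebra all_field.
From mathcomp Require Import mxtens.

Set Implicit Arguments.
Unset Strict Implicit.
Unset Printing Implicit Defensive.

Import Order.TTheory GRing.Theory Num.Theory.

(** Let [l] and [k] be the Laplacian eigenvalues of [G1] and [G2] other than the
    eigenvalue [0] of the constant vector. By the matrix-tree theorem
    [n1 * tau G1] and [n2 * tau G2] are the products of the [l_i] and of the [k_j].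
    The Laplacian of the Cartesian product is [L1 (x) 1 + 1 (x) L2], with
    eigenvalues [l_i + k_j], so [tau (G1 [] G2)] is [tau G1 * tau G2] times the
    product of all [l_i + k_j]. The bound is AM-GM for these numbers, whose sum
    is read off the traces of [L1] and [L2]. Equality forces all [l_i] and all
    [k_j] to be equal, so that each Laplacian is a combination of the identity and
    the all-ones matrix.

    The matrix-tree theorem is obtained by expanding the grounded Laplacian
    determinant row by row: only the functions sending each vertex other than the
    root to a neighbour, all of whose orbits reach the root, contribute, each
    with [1], and they are in bijection with the spanning trees. *)

(** * Spanning trees as parent functions *)

(** Each [v] other than [r] is sent to a neighbour strictly closer to [r], distance being the least
    length of a path to [r]; iteration must then end in [r]. *)
Lemma bfs_parent (V : finType) (e : rel V) (r : V) :
    (forall v, connect e v r) ->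
  exists f : {ffun V -> V}, [/\ f r = r, forall v, v != r -> e v (f v)
    & forall v, fconnect f v r].
Proof.
move=> conn; pose P v k := [exists p : k.-tuple V, path e v p && (last v p == r)].
have exP v : exists k, P v k.
  have /connectP[p ep lp] := conn v; exists (size p).
  by apply/existsP; exists (in_tuple p); rewrite ep -lp /=.
pose d v := ex_minn (exP v).
have closer v : v != r -> exists u, e v u && (d u < d v).
  rewrite {2}/d; case: ex_minnP => k /existsP[[[|u p] /= /eqP <-]].
    by move=> /eqP -> _; rewrite eqxx.
  case/andP=> /andP[evu ep] lp _ _; exists u; rewrite evu ltnS /d.
  case: ex_minnP => m _; apply; apply/existsP.
  by exists (in_tuple p); rewrite ep.
(* The default [v] is never taken: [closer] makes the [pick] succeed whenever [v != r]. *)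
pose f := [ffun v => if v == r then r else
             odflt v [pick u | e v u && (d u < d v)]].
have fP v : v != r -> e v (f v) && (d (f v) < d v).
  move=> vr; rewrite ffunE (negPf vr); case: pickP => [u //|none].
  by have [u] := closer v vr; rewrite none.
exists f; split=> [|v /fP/andP[]//|v]; first by rewrite ffunE eqxx.
have [m] := ubnP (d v); elim: m v => // m IH v dv.
have [->|vr] := eqVneq v r; first exact: connect0.
have /andP[_ ltd] := fP v vr.
by apply: connect_trans (fconnect1 f v) (IH _ _); apply: leq_trans ltd dv.
Qed.

(** The depth is the least number of steps to [r]. It serves as induction measure and singles out a
    deepest vertex of a cycle. *)
Lemma fconnect_depth (V : finType) (f : V -> V) (r : V) :
    (forall v, fconnect f v r) ->
  exists d : V -> nat, forall v, v != r -> d v = (d (f v)).+1.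
Proof.
move=> conn.
have exP v : exists k, iter k f v == r.
  by exists (findex f v r); rewrite iter_findex.
exists (fun v => ex_minn (exP v)) => v vr.
case: ex_minnP => k /eqP kr kmin; case: ex_minnP => m /eqP mr mmin.
apply/eqP; rewrite eqn_leq kmin; last by rewrite iterSr mr.
case: k kr {kmin} => [/= vr'|k]; first by rewrite vr' eqxx in vr.
by rewrite iterSr ltnS => /eqP/mmin.
Qed.

Lemma set2_eq (T : finType) (a b c d : T) : [set a; b] = [set c; d] ->
  (a = c /\ b = d) \/ (a = d /\ b = c).
Proof.
move=> E.
have: a \in [set c; d] by rewrite -E !inE eqxx.
have: b \in [set c; d] by rewrite -E !inE eqxx orbT.
have: c \in [set a; b] by rewrite E !inE eqxx.
have: d \in [set a; b] by rewrite E !inE eqxx orbT.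
rewrite !inE => /orP[]/eqP e1 /orP[]/eqP e2 /orP[]/eqP e3 /orP[]/eqP e4;
  subst; by [left|right].
Qed.

Section Arborescence.
Variables (G : sgraph) (r : G).
Implicit Types f g : {ffun G -> G}.

(** A parent function, made total by letting the root be its own parent. That all orbits reach [r]
    excludes every other cycle of [f]. *)
Definition arborescence f :=
  [&& f r == r, [forall v, (v != r) ==> sedge v (f v)]
    & [forall v, fconnect f v r]].

Lemma arborescenceP f :
  reflect [/\ f r = r, forall v, v != r -> sedge v (f v)
             & forall v, fconnect f v r] (arborescence f).
Proof.
apply: (iffP and3P) => -[fr fe fc]; split.
- exact/eqP.
- by move=> v vr; have /forallP/(_ v)/implyP/(_ vr) := fe.
- exact/forallP.
- exact/eqP.
- by apply/forallP=> v; apply/implyP=> /fe.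
- exact/forallP.
Qed.

Definition parent_edges f : {set {set G}} := [set [set v; f v] | v in [set~ r]].

Lemma in_parent_edges f x y : ([set x; y] \in parent_edges f) =
  (x != r) && (f x == y) || (y != r) && (f y == x).
Proof.
apply/imsetP/orP => [[v] | [] /andP[xr /eqP <-]].
- rewrite !inE => vr /set2_eq[] [-> ->]; rewrite vr eqxx; by [left|right].
- by exists x; rewrite ?inE.
- by exists y; rewrite ?inE // setUC.
Qed.

Lemma parent_edges_span f x : arborescence f -> x != r ->
  span_rel (parent_edges f) x (f x).
Proof.
case/arborescenceP=> _ fe _ xr; rewrite /span_rel /= in_parent_edges xr eqxx /=.
by rewrite andbT; apply: contraTneq (fe x xr) => <-; rewrite sedge_irrefl.
Qed.

Lemma parent_edges_sub f : arborescence f -> parent_edges f \subset edges G.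
Proof.
case/arborescenceP=> _ fe _.
by apply/subsetP=> E /imsetP[v]; rewrite !inE => /fe evf ->; rewrite in_edges.
Qed.

Lemma parent_edges_connect f x : arborescence f ->
  connect (span_rel (parent_edges f)) x r.
Proof.
move=> arb; have [fr fe fc] := arborescenceP _ arb.
rewrite -(iter_findex (fc x)); elim: (findex f x r) => [|k IH] /=.
  exact: connect0.
apply: connect_trans IH _; set y := iter k f x.
have [->|yr] := eqVneq y r; first by rewrite fr connect0.
exact/connect1/parent_edges_span.
Qed.

(* In a cycle, both neighbours of a vertex of maximal depth would be its parent. *)
Lemma parent_edges_acyclic f : arborescence f ->
  acyclic (span_graph (parent_edges f)).
Proof.
move=> arb; have [fr fe fc] := arborescenceP _ arb.
have [d dP] := fconnect_depth fc.
apply/acyclicP=> s s2 /andP[cs us].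
case: s s2 cs us => // x0 s0; set s := x0 :: s0 => s2 cs us.
have [x xs xmax] : exists2 x, x \in s & forall y, y \in s -> d y <= d x.
  exists [arg max_(x > x0 in s) d x].
    by case: arg_maxnP; rewrite ?inE ?eqxx.
  by move=> y ys; case: arg_maxnP; rewrite ?inE ?eqxx // => i _; apply.
have nbr y : y \in s -> span_rel (parent_edges f) x y -> f x = y.
  move=> ys /andP[_]; rewrite in_parent_edges => /orP[]/andP[xr /eqP] // E.
  by have := xmax y ys; rewrite (dP y xr) E ltnn.
(* Rotate the cycle to start at [x]: [p] and [q] are then its second and last vertices, distinct
   because there are at least three. *)
have [p [q [xp [xq [pNq]]]]] : exists p q, span_rel (parent_edges f) x p /\
    (span_rel (parent_edges f) x q) /\ p <> q /\ p \in s /\ q \in s.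
  have [i t Et] := rot_to xs.
  have ct : path.cycle (span_rel (parent_edges f)) (x :: t) by rewrite -Et rot_cycle.
  have ut : uniq (x :: t) by rewrite -Et rot_uniq.
  have st : size (x :: t) = size s by rewrite -Et size_rot.
  have mt y : y \in t -> y \in s.
    by move=> yt; rewrite -(mem_rot i) Et inE yt orbT.
  rewrite -st in s2; case: t ct ut s2 mt {st Et} => [//|p t] /=.
  case/lastP: t => [//|t q] /=.
  rewrite rcons_path last_rcons => /and3P[xp _ xq].
  rewrite !inE !mem_rcons !inE !negb_or => /andP[_ /andP[/andP[pq _] _]] _ mt.
  exists p, q; split=> //; split; first by rewrite span_rel_sym.
  split; first exact/eqP.
  by split; apply: mt; rewrite ?inE ?eqxx // mem_rcons inE eqxx orbT.
by case=> ps qs; apply: pNq; rewrite -(nbr p) // (nbr q).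
Qed.

Lemma parent_edges_spanning_tree f : arborescence f ->
  parent_edges f \in spanning_trees G.
Proof.
move=> arb; rewrite inE parent_edges_sub // /is_tree parent_edges_acyclic //.
rewrite andbT; apply/forallP=> x; apply/forallP=> y.
apply: connect_trans (parent_edges_connect x arb) _.
by rewrite (sym_connect_sym (@span_rel_sym _ _)) parent_edges_connect.
Qed.

(** Induction on depth. If [g] used the edge between [v] and [f v] in the other direction, the
    induction hypothesis at [f v] would give [f (f v) = v], putting [v] two levels below itself. *)
Lemma parent_edges_inj :
  {in [pred f | arborescence f] &, injective parent_edges}.
Proof.
move=> f g arbf arbg Efg.
have [fr fe fc] := arborescenceP _ arbf; have [gr ge gc] := arborescenceP _ arbg.
have [d dP] := fconnect_depth fc; apply/ffunP=> v.
have [m] := ubnP (d v); elim: m v => // m IH v dv.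
have [->|vr] := eqVneq v r; first by rewrite fr gr.
have: [set v; f v] \in parent_edges g.
  by rewrite -Efg in_parent_edges vr eqxx.
rewrite in_parent_edges => /orP[/andP[_ /eqP //]|/andP[fvr /eqP gfv]].
have /IH : d (f v) < m by rewrite -ltnS -(dP v vr).
rewrite gfv => ffv; move: (dP _ vr) (dP _ fvr); rewrite ffv => -> /eqP.
by rewrite -addn2 -[X in X == _]addn0 eqn_add2l.
Qed.

(* An edge missing from a breadth-first tree of [F] would close a cycle in [F]. *)
Lemma spanning_tree_parent F : F \in spanning_trees G ->
  exists2 f, arborescence f & F = parent_edges f.
Proof.
rewrite inE => /andP[FG /andP[/forallP Fc /acyclicP Fa]].
have sub2 x y : [set x; y] \in F -> sedge x y.
  by move=> xyF; rewrite -in_edges; apply: (subsetP FG).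
have [v|f [fr fe fc]] := @bfs_parent _ (span_rel F) r.
  exact: (forallP (Fc v)).
have arb : arborescence f.
  by apply/arborescenceP; split=> // v /fe/andP[_ /sub2].
have subF : parent_edges f \subset F.
  by apply/subsetP=> E /imsetP[v]; rewrite !inE => /fe/andP[_ vF] ->.
exists f => //; apply/eqP; rewrite eqEsubset subF andbT; apply/subsetP=> E EF.
have /imsetP[[x y]] := subsetP FG _ EF; rewrite inE /= => exy EE.
rewrite {E}EE in EF *; apply: contraT => xyNf.
have xy : x != y by apply: contraTneq exy => ->; rewrite sedge_irrefl.
have : connect (span_rel (parent_edges f)) x y.
  apply: connect_trans (parent_edges_connect x arb) _.
  by rewrite (sym_connect_sym (@span_rel_sym _ _)) parent_edges_connect.
case/connectP=> p0 /shortenP[p pe pu _] yE {p0}.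
have subr : subrel (span_rel (parent_edges f)) (span_rel F).
  by move=> a b /andP[ab abf]; rewrite /span_rel /= ab (subsetP subF).
(* The edge from [y] back to [x] closes the path. With three or more vertices this is a cycle in
   [F]; otherwise the path is trivial or is that edge itself. *)
have := Fa (x :: p); case; last first.
  rewrite /ucycle /ucycleb pu andbT /= rcons_path (sub_path subr) //= -yE.
  by rewrite /span_rel /= eq_sym xy setUC EF.
case: p pe pu yE => [_ _ /= yx|z [|//]] /=.
  by rewrite yx eqxx in xy.
by rewrite andbT => /andP[_ xzf] _ yz; rewrite yz xzf in xyNf.
Qed.

Lemma tau_arborescence : tau G = #|[set f | arborescence f]|.
Proof.
rewrite /tau -(card_in_imset (f := parent_edges)); last first.
  by move=> f g; rewrite !inE; apply: parent_edges_inj.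
congr #|pred_of_set _|; apply/setP=> F; apply/idP/imsetP => [/spanning_tree_parent|].
  by case=> f arb ->; exists f => //; rewrite inE.
by case=> f; rewrite inE => arb ->; apply: parent_edges_spanning_tree.
Qed.

End Arborescence.

Lemma tau_gt0 (G : sgraph) : 0 < #|G| -> (0 < tau G) = connected G.
Proof.
case/card_gt0P=> r _; apply/idP/idP => [|Gc].
  case/card_gt0P=> F; rewrite inE => /andP[/subsetP FG /andP[/forallP Fc _]].
  apply/forallP=> x; apply/forallP=> y.
  have /forallP/(_ y) := Fc x; apply: connect_sub => a b /andP[_ /FG].
  by rewrite in_edges => /connect1.
have [v|f [fr fe fc]] := @bfs_parent _ (@sedge G) r.
  by have /forallP/(_ v)/forallP := Gc.
rewrite (tau_arborescence r); apply/card_gt0P; exists f; rewrite inE.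
exact/arborescenceP.
Qed.

(** Handshake count: each edge comes from exactly two ordered pairs. *)
Lemma sum_card_sedge (G : sgraph) :
  \sum_(x : G) #|[pred y | sedge x y]| = 2 * #|edges G|.
Proof.
have -> : \sum_(x : G) #|[pred y | sedge x y]| =
    \sum_(p : G * G | sedge p.1 p.2) 1.
  rewrite -(pair_big_dep xpredT (fun x y => sedge x y) (fun _ _ => 1)) /=.
  by apply: eq_bigr => x _; rewrite sum1_card.
rewrite (partition_big (fun p => [set p.1; p.2]) (fun E => E \in edges G)) /=.
  rewrite -sum1_card big_distrr /=; apply: eq_bigr => E /imsetP[[x y]].
  rewrite inE /= => exy ->; rewrite sum1_card.
  have xy : (x, y) != (y, x).
    by apply: contraTneq exy => -[-> _]; rewrite sedge_irrefl.
  transitivity #|[set (x, y); (y, x)]|; last by rewrite cards2 xy.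
  apply: eq_card => -[a b]; rewrite !inE /=; apply/andP/orP.
    by case=> _ /eqP/set2_eq[] /= [-> ->]; [left|right].
  by case=> /eqP[-> ->]; rewrite ?(sedge_sym y) exy // setUC.
by move=> p ep; rewrite in_edges.
Qed.

(** * The matrix-tree theorem *)

Local Open Scope ring_scope.

Lemma fconnect_step (T : finType) (f : T -> T) (x y : T) :
  x != y -> fconnect f x y = fconnect f (f x) y.
Proof.
move=> xy; apply/idP/idP; last exact: connect_trans (fconnect1 f x).
move=> fc; have E := iter_findex fc; case: (findex f x y) E => [|k] /=.
  by move=> E; rewrite E eqxx in xy.
by rewrite -iterS iterSr => <-; apply: fconnect_iter.
Qed.

(* When every orbit reaches [r], only the identity survives in the Leibniz
   expansion; otherwise the matrix kills the indicator of the points whose orbit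
   avoids [r]. *)
Lemma det_sub_functional_graph (F : fieldType) n (f : 'I_n -> 'I_n) (r : 'I_n) :
  \det (\matrix_(i, j) ((i == j)%:R - (i != r)%:R * (f i == j)%:R) : 'M[F]_n) =
  [forall v, fconnect f v r]%:R.
Proof.
set A := \matrix_(i, j) _; case: forallP => [fc|nfc]; last first.
  have /existsP[v0 v0N] : [exists v, ~~ fconnect f v r].
    by apply: contraT; rewrite negb_exists => /forallP H; case: nfc => v;
       have := H v; rewrite negbK.
  apply/eqP; rewrite -det_tr; apply/det0P.
  exists (\row_v (~~ fconnect f v r)%:R).
    apply: contraNneq v0N => /rowP/(_ v0); rewrite !mxE.
    by case: (fconnect f v0 r) => // /eqP; rewrite oner_eq0.
  apply/rowP=> i; rewrite !mxE.
  under eq_bigr do rewrite !mxE mulrBr.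
  rewrite sumrB (bigD1 i) //= eqxx mulr1 big1 ?addr0; last first.
    by move=> j ji; rewrite eq_sym (negPf ji) mulr0.
  rewrite (bigD1 (f i)) //= eqxx mulr1 big1 ?addr0; last first.
    by move=> j ji; rewrite [f i == j]eq_sym (negPf ji) !mulr0.
  have [->|ir] := eqVneq i r; first by rewrite connect0 mulr0 subr0.
  by rewrite -fconnect_step // mulr1 subrr.
rewrite /determinant (bigD1 (1%g : 'S_n)) //= odd_perm1 mul1r.
rewrite [X in _ + X]big1 ?addr0 => [|s s1].
  rewrite big1 // => i _; rewrite !mxE perm1 eqxx.
  have [->|ir] := eqVneq i r; first by rewrite mul0r subr0.
  rewrite mul1r; have [E|_] := eqVneq (f i) i; last by rewrite subr0.
  have := fc i; move/iter_findex; set k := findex _ _ _.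
  have -> : iter k f i = i by elim: k => //= k ->.
  by move=> E'; rewrite E' eqxx in ir.
have [v sv] : exists v, s v != v.
  apply/existsP; rewrite -negb_forall; apply: contra s1 => /forallP E.
  by apply/eqP/permP=> i; rewrite perm1; apply/eqP.
suff [i Ai] : exists i, A i (s i) = 0.
  by rewrite (bigD1 i) //= Ai mul0r mulr0.
case: (pickP [pred i | A i (s i) == 0]) => [i /eqP|nz]; first by exists i.
(* If no factor vanished, [s] would agree with [f] at every point it moves, hence move the whole
   [f]-orbit of [v]. That orbit contains [r], where [A] has an identity row. *)
have sE i : s i != i -> (i != r) && (f i == s i).
  move=> si; have := negbT (nz i); rewrite /= !mxE [i == s i]eq_sym (negPf si) sub0r oppr_eq0 mulf_eq0.
  by case: (i != r); case: (f i == s i); rewrite ?eqxx ?orbT.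
have mv k : s (iter k f v) != iter k f v.
  elim: k => //= k IH; have /andP[_ /eqP ->] := sE _ IH.
  by rewrite (inj_eq perm_inj).
by have := mv (findex f v r); rewrite (iter_findex (fc v)) => /sE; rewrite eqxx.
Qed.

Section Laplacian.
Variables (F : fieldType) (G : sgraph) (n : nat) (e : 'I_n -> G).
Hypothesis e_bij : bijective e.

(** Indexed through an enumeration [e] of the vertices, so that products can later be enumerated to
    match Kronecker products. *)
Definition laplacian : 'M[F]_n := \matrix_(i, j)
  ((i == j)%:R * #|[pred y | sedge (e i) y]|%:R - (sedge (e i) (e j))%:R).

Lemma sum_sedge i : \sum_j (sedge (e i) (e j))%:R =
  #|[pred y | sedge (e i) y]|%:R :> F.
Proof.
rewrite -sum1_card natr_sum [RHS]big_mkcond [RHS](reindex e) /=; last exact: onW_bij.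
by apply: eq_bigr => j _; rewrite inE; case: sedge.
Qed.

Lemma laplacian_tr : laplacian^T = laplacian.
Proof.
apply/matrixP=> i j; rewrite !mxE (sedge_sym (e j)) eq_sym.
by have [->|] := eqVneq i j; rewrite ?mul0r.
Qed.

Lemma laplacian_const : laplacian *m const_mx 1 = 0 :> 'cV_n.
Proof.
apply/colP=> i; rewrite !mxE; under eq_bigr do rewrite !mxE mulr1.
rewrite sumrB sum_sedge (bigD1 i) //= eqxx mul1r big1 ?addr0 ?subrr //.
by move=> j ji; rewrite eq_sym (negPf ji) mul0r.
Qed.

Lemma const_laplacian : const_mx 1 *m laplacian = 0 :> 'rV_n.
Proof.
by rewrite -laplacian_tr -trmx_const -trmx_mul laplacian_const trmx0.
Qed.

(** Replacing row [r] by a unit row gives the same determinant as deleting row and column [r], but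
    keeps the size [n]. *)
Definition grounded_laplacian r : 'M[F]_n :=
  \matrix_(i, j) if i == r then (j == r)%:R else laplacian i j.

(** Transports the count along [e] to functions on indices, the form in which a determinant
    expansion produces them. *)
Lemma card_arborescence_conj r :
  #|[set f : {ffun 'I_n -> 'I_n} | [&& f r == r,
      [forall v, (v != r) ==> sedge (e v) (e (f v))]
      & [forall v, fconnect f v r]]]| = tau G.
Proof.
have [e' eK e'K] := e_bij; have e_inj := can_inj eK.
pose h (f : {ffun 'I_n -> 'I_n}) : {ffun G -> G} := [ffun x => e (f (e' x))].
have h_inj : injective h.
  by move=> f g /ffunP E; apply/ffunP=> i; have := E (e i);
     rewrite !ffunE eK => /e_inj.
rewrite (tau_arborescence (e r)) -(card_imset _ h_inj).
have hiter f k v : iter k (h f) (e v) = e (iter k f v).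
  by elim: k => //= k ->; rewrite ffunE eK.
have arbE f : arborescence (e r) (h f) = [&& f r == r,
      [forall v, (v != r) ==> sedge (e v) (e (f v))]
      & [forall v, fconnect f v r]].
  apply/arborescenceP/and3P=> -[fr fe fc]; split.
  - by move: fr; rewrite ffunE eK => /e_inj/eqP.
  - apply/forallP=> v; apply/implyP=> vr; have := fe (e v).
    by rewrite ffunE eK (inj_eq e_inj); apply.
  - apply/forallP=> v; have := iter_findex (fc (e v)); rewrite hiter => /e_inj.
    by move=> <-; apply: fconnect_iter.
  - by rewrite ffunE eK (eqP fr).
  - move=> x; rewrite -[x]e'K (inj_eq e_inj) => xr; rewrite ffunE eK.
    by have /forallP/(_ (e' x)) := fe; rewrite xr.
  - move=> x; rewrite -[x]e'K; have /forallP/(_ (e' x)) := fc.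
    by move/iter_findex=> <-; rewrite -hiter fconnect_iter.
congr #|pred_of_set _|; apply/setP=> g; apply/imsetP/idP.
  by case=> f; rewrite !inE -arbE => arb ->.
move=> arb; have hg : g = h [ffun i => e' (g (e i))].
  by apply/ffunP=> x; rewrite !ffunE !e'K.
by eexists; last exact: hg; rewrite inE -arbE -hg; rewrite inE in arb.
Qed.

(* Each row of the Laplacian is a sum over neighbours of [e_i - e_u]; expanding
   the determinant over one choice of neighbour per row leaves a sum over
   parent functions. *)
Lemma det_grounded_laplacian r : \det (grounded_laplacian r) = (tau G)%:R.
Proof.
(* [c i u] tells whether [u] may be chosen for row [i], and [m i u] is the row this choice
   contributes. Row [r] has the single choice [r], contributing a unit row. *)
pose c i u : F := (if i == r then u == r else sedge (e i) (e u))%:R.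
pose m i u j : F := (i == j)%:R - (i != r)%:R * (u == j)%:R.
have gE i j : grounded_laplacian r i j = \sum_u c i u * m i u j.
  rewrite mxE /c /m; have [->|ir] := eqVneq i r; last first.
    under eq_bigr do rewrite mul1r mulrBr; rewrite sumrB -mulr_suml sum_sedge mxE.
    congr (_ - _); first by rewrite mulrC.
    rewrite (bigD1 j) //= eqxx mulr1 big1 ?addr0 // => u uj.
    by rewrite (negPf uj) mulr0.
  rewrite (bigD1 r) //= eqxx mul1r mul0r subr0 big1 ?addr0 => [|u ur].
    by rewrite eq_sym.
  by rewrite (negPf ur) mul0r.
rewrite /determinant.
under eq_bigr => s _.
  under eq_bigr do rewrite gE.
  rewrite bigA_distr_bigA /= mulr_sumr.
  under eq_bigr => f _ do rewrite big_split /= mulrCA.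
  over.
rewrite exchange_big /= -(card_arborescence_conj r) -sum1_card natr_sum.
rewrite [RHS]big_mkcond /=; apply: eq_bigr => f _.
rewrite -mulr_sumr.
have -> : \sum_(s : 'S_n) (-1) ^+ s * \prod_i m i (f i) (s i) =
    [forall v, fconnect f v r]%:R.
  rewrite -det_sub_functional_graph; apply: eq_bigr => s _.
  by congr (_ * _); apply: eq_bigr => i _; rewrite mxE.
rewrite inE; case: (boolP [forall v, fconnect f v r]) => fc; last first.
  by rewrite mulr0 !andbF.
rewrite mulr1 andbT; case: ifP => [/andP[/eqP fr /forallP fe]|].
  rewrite big1 // => i _; rewrite /c; have [->|ir] := eqVneq i r.
    by rewrite fr eqxx.
  by have := fe i; rewrite ir /= => ->.
move=> nf; apply/eqP; rewrite prodf_seq_eq0 /=; apply/hasP.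
have [fr|fr] := eqVneq (f r) r; last first.
  by exists r; rewrite ?mem_index_enum // /c eqxx (negPf fr).
move: nf; rewrite fr eqxx /= => /negbT; rewrite negb_forall => /existsP[v].
rewrite negb_imply => /andP[vr nv]; exists v; rewrite ?mem_index_enum //.
by rewrite /c (negPf vr) (negPf nv).
Qed.

End Laplacian.

(** Multiplying the block matrix [A] by the same unitriangular matrix on the right and on the left
    yields two block triangular matrices of equal determinant. *)
Lemma det_addmx1_outer (F : fieldType) n (u : 'cV[F]_n) (v : 'rV[F]_n) :
  \det (1%:M + u *m v) = 1 + (v *m u) 0 0.
Proof.
pose A := block_mx 1%:M (- v) u 1%:M : 'M_(1 + n).
have E1 : A *m block_mx 1%:M v 0 1%:M = block_mx 1%:M 0 u (1%:M + u *m v).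
  rewrite mulmx_block ?(mulmx1, mul1mx, mulmx0, mul0mx, addr0, add0r) subrr.
  by rewrite addrC.
have E2 : block_mx 1%:M v 0 1%:M *m A = block_mx (1%:M + v *m u) 0 u 1%:M.
  by rewrite mulmx_block ?(mulmx1, mul1mx, mulmx0, mul0mx, addr0, add0r) addNr.
have := congr1 determinant E1; rewrite det_mulmx mulrC -det_mulmx E2.
rewrite !det_lblock !det1 mul1r mulr1 => <-.
by rewrite det_mx11 !mxE eqxx.
Qed.

(** Rank-one modifications of the identity, of determinants [1], [n] and [n], turn the grounded
    Laplacian into [L] plus the all-ones matrix, which can be diagonalized together with [L]. *)
Lemma matrix_tree (F : fieldType) (G : sgraph) n (e : 'I_n -> G) :
    bijective e -> (0 < n)%N ->
  \det (laplacian F e + const_mx 1) = n%:R ^+ 2 * (tau G)%:R.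
Proof.
move=> eb n0; pose r := Ordinal n0; set L := laplacian F e.
pose j : 'cV[F]_n := const_mx 1; pose d : 'cV[F]_n := delta_mx r 0.
have jT : j^T = const_mx 1 by rewrite trmx_const.
have jL : j^T *m L = 0 by rewrite jT const_laplacian.
have Lj : L *m j = 0 by rewrite laplacian_const.
have jd : j^T *m d = 1%:M.
  by rewrite -colE jT; apply/matrixP=> a b; rewrite !mxE !ord1.
have djT : d^T *m j = 1%:M by rewrite -[j]trmxK -trmx_mul jd trmx1.
have jj : j^T *m j = (n%:R)%:M.
  apply/matrixP=> a b; rewrite !mxE !ord1 eqxx.
  by under eq_bigr do rewrite !mxE mulr1; rewrite sumr_const card_ord.
have dd : d^T *m d = 1%:M.
  by rewrite -[d^T]trmxK -colE trmx_delta; apply/matrixP=> a b; rewrite !mxE !ord1 !eqxx.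
have trB (u v : 'cV[F]_n) : (u - v)^T = u^T - v^T by rewrite linearB.
have d1 (u : 'rV[F]_n) : d *m u = \matrix_(a, b) ((a == r)%:R * u 0 b).
  by apply/matrixP=> a b; rewrite !mxE big_ord1 !mxE eqxx andbT.
have dL : d^T *m L = row r L by rewrite trmx_delta -rowE.
have gE : grounded_laplacian F e r = L + d *m (d^T - d^T *m L).
  rewrite dL d1; apply/matrixP=> a b; rewrite !mxE.
  have [->|_] := eqVneq a r; last by rewrite mul0r addr0.
  by rewrite mul1r andbT addrC subrK.
have dj0 : (d - j)^T *m d = 0 by rewrite trB mulmxBl dd jd subrr.
(* Subtracting the other rows from row [r] restores row [r] of [L], whose rows sum to zero, and
   keeps the unit entry at the root. *)
have E1 : (1%:M + d *m (d - j)^T) *m grounded_laplacian F e r = L + d *m d^T.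
  rewrite gE mulmxDl mul1mx -mulmxA [(d - j)^T *m _]mulmxDr mulmxA dj0 mul0mx.
  by rewrite addr0 trB mulmxBl jL subr0 -addrA -mulmxDr subrK.
(* The rows of [L + d *m d^T] sum to [d^T]; adding this sum to every row except [r] gives
   [L + j *m d^T]. The same operation on columns fills in the all-ones matrix. *)
have E2 : (1%:M + (j - d) *m j^T) *m (L + d *m d^T) *m (1%:M + j *m (j - d)^T) =
    L + const_mx 1.
  have -> : (1%:M + (j - d) *m j^T) *m (L + d *m d^T) = L + j *m d^T.
    rewrite mulmxDl mul1mx -mulmxA [j^T *m _]mulmxDr jL add0r.
    by rewrite [j^T *m _]mulmxA jd mul1mx -addrA -mulmxDl [d + _]addrC subrK.
  rewrite mulmxDr mulmx1 mulmxA [(L + _) *m j]mulmxDl Lj add0r.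
  rewrite -[j *m _ *m j]mulmxA djT mulmx1 -addrA -mulmxDr trB [d^T + _]addrC subrK; congr (_ + _).
  by apply/matrixP=> a b; rewrite !mxE big_ord1 !mxE mulr1.
have D1 : \det (1%:M + d *m (d - j)^T) = 1.
  by rewrite det_addmx1_outer dj0 mxE addr0.
have D2 : \det (1%:M + (j - d) *m j^T) = n%:R.
  by rewrite det_addmx1_outer mulmxBr jj jd !mxE eqxx !mulr1n [1 + _]addrC subrK.
have D3 : \det (1%:M + j *m (j - d)^T) = n%:R.
  by rewrite det_addmx1_outer trB mulmxBl jj djT !mxE eqxx !mulr1n [1 + _]addrC subrK.
rewrite -E2 -E1 !det_mulmx det_grounded_laplacian // D1 D2 D3.
by rewrite mul1r mulrAC -expr2.
Qed.

(** * Laplacian spectra *)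

Lemma realsym_diagonalizable (C : numClosedFieldType) n (A : 'M[C]_n) :
  A^T = A -> A \is a mxOver Num.real -> diagonalizable A.
Proof.
move=> Asym Areal.
have /symmetric_normalmx/(_ Areal)/orthomx_spectralP E : A \is symmetricmx.
  by apply/is_hermitianmxP; rewrite expr0 scale1r map_mx_id.
move: E (spectral_unit A); move: (spectralmx A) (spectral_diag A) => P D E Pu.
exists P => //; apply/similar_diagPex; exists D; apply/(similarRL Pu).
by rewrite E !mulmxA mulmxV // mul1mx mulmxK.
Qed.

Section Spectrum.
Variable (C : numClosedFieldType).

(* [l] lists the Laplacian eigenvalues in a basis, the rows of [P], that also
   diagonalizes the all-ones matrix; [i0] is the position of the constant vector. *)
Definition laplacian_spectrum (G : sgraph) n (e : 'I_n -> G)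
    (P : 'M[C]_n) (l : 'rV[C]_n) (i0 : 'I_n) :=
  [/\ P \in unitmx, P *m laplacian C e = diag_mx l *m P,
      P *m const_mx 1 = diag_mx (n%:R *: delta_mx 0 i0) *m P & l 0 i0 = 0].

(** [L] and [J] are real symmetric with [LJ = JL = 0], hence simultaneously diagonalizable. From
    [JJ = nJ] the eigenvalues of [J] are [0] or [n], and its trace [n] leaves exactly one [n], at
    [i0]; there [LJ = 0] forces [l] to vanish. *)
Lemma exists_laplacian_spectrum (G : sgraph) n (e : 'I_n -> G) :
    bijective e -> (0 < n)%N ->
  exists P l i0, laplacian_spectrum e P l i0.
Proof.
move=> eb n0; set L := laplacian C e; pose J : 'M[C]_n := const_mx 1.
have nz : n%:R != 0 :> C by rewrite pnatr_eq0 -lt0n.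
have JE : J = const_mx 1 *m (const_mx 1 : 'rV[C]_n).
  by apply/matrixP=> i j; rewrite !mxE big_ord1 !mxE mulr1.
have LJ : L *m J = 0 by rewrite JE mulmxA laplacian_const // mul0mx.
have JL : J *m L = 0 by rewrite JE -mulmxA const_laplacian // mulmx0.
have JJ : J *m J = n%:R *: J.
  apply/matrixP=> i j; rewrite !mxE; under eq_bigr do rewrite !mxE mulr1.
  by rewrite sumr_const card_ord mulr1.
have [P Pu PD] : codiagonalizable [:: L; J].
  apply/codiagonalizableP; split=> [f g|f].
    by rewrite !inE => /orP[]/eqP-> /orP[]/eqP->; rewrite /comm_mx ?LJ ?JL.
  rewrite !inE => /orP[]/eqP->; apply: realsym_diagonalizable.
  - exact: laplacian_tr.
  - by apply/mxOverP=> i j; rewrite mxE -natrM rpredB // realn.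
  - exact: trmx_const.
  - by apply/mxOverP=> i j; rewrite mxE real1.
move: PD; rewrite /= andbT => /andP[/similar_diagPex[l /similarP-/(_ Pu) PL]].
move=> /similar_diagPex[v /similarP-/(_ Pu) PJ].
have diag_inj (d1 d2 : 'rV[C]_n) : diag_mx d1 *m P = diag_mx d2 *m P ->
    forall i, d1 0 i = d2 0 i.
  move=> E i; have /matrixP/(_ i i) := can_inj (mulmxK Pu) E.
  by rewrite !mxE eqxx !mulr1n.
have v2 i : v 0 i * v 0 i = n%:R * v 0 i.
  have := diag_inj (\row_j (v 0 j * v 0 j)) (n%:R *: v).
  rewrite -mulmx_diag -mulmxA -PJ mulmxA -PJ -mulmxA JJ -scalemxAr PJ.
  rewrite scalemxAl -[n%:R *: diag_mx v]linearZ => /(_ erefl i).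
  by rewrite !mxE.
have lv i : l 0 i * v 0 i = 0.
  have := diag_inj (\row_j (l 0 j * v 0 j)) 0.
  rewrite -mulmx_diag -mulmxA -PJ mulmxA -PL -mulmxA LJ mulmx0 linear0 mul0mx.
  by move=> /(_ erefl i); rewrite !mxE.
have vE i : v 0 i = n%:R * (v 0 i != 0)%:R.
  have [->|vi] := eqVneq (v 0 i) 0; first by rewrite mulr0.
  by rewrite mulr1; apply: (mulIf vi).
have trv : \sum_i v 0 i = n%:R.
  have : \tr (invmx P *m (P *m J)) = \tr (diag_mx v).
    by rewrite mxtrace_mulC PJ mulmxK.
  rewrite mulKmx // mxtrace_diag => <-; rewrite /mxtrace.
  by under eq_bigr do rewrite mxE; rewrite sumr_const card_ord.
have /card1P[i0 vi0] : #|[pred i | v 0 i != 0]| == 1%N.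
  rewrite -(eqr_nat C) -(inj_eq (mulfI nz)) mulr1 -{2}trv.
  rewrite -sum1_card natr_sum mulr_sumr big_mkcond /=; apply/eqP/eq_bigr=> i _.
  by rewrite [RHS]vE inE; case: ifP; rewrite ?mulr1 ?mulr0.
exists P, l, i0.
have vi i : (v 0 i != 0) = (i == i0) by have := vi0 i; rewrite !inE.
split=> //; last first.
  have /eqP := lv i0; rewrite mulf_eq0 => /orP[/eqP //|].
  by have := vi i0; rewrite eqxx => /negPf ->.
rewrite PJ; congr (diag_mx _ *m P); apply/rowP=> i.
by rewrite !mxE vE vi eqxx.
Qed.

Section Properties.
Variables (G : sgraph) (n : nat) (e : 'I_n -> G) (P : 'M[C]_n) (l : 'rV[C]_n).
Variable (i0 : 'I_n).
Hypotheses (e_bij : bijective e) (PlP : laplacian_spectrum e P l i0).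

Let n_gt0 : (0 < n)%N. Proof. exact: leq_ltn_trans (leq0n i0) (ltn_ord i0). Qed.

(** [L + J] has eigenvalue [n] at [i0] and [l 0 i] elsewhere; cancel one [n] in the matrix-tree
    formula. *)
Lemma tau_spectrum : n%:R * (tau G)%:R = \prod_(i | i != i0) l 0 i.
Proof.
have nz : n%:R != 0 :> C by rewrite pnatr_eq0 -lt0n.
have [Pu PL PJ l0] := PlP; apply: (mulfI nz); rewrite mulrA -expr2.
rewrite -(matrix_tree C e_bij n_gt0).
have -> : laplacian C e + const_mx 1 =
    invmx P *m diag_mx (l + n%:R *: delta_mx 0 i0) *m P.
  by rewrite -mulmxA linearD /= mulmxDl -PL -PJ -mulmxDr mulKmx.
rewrite !det_mulmx mulrAC -det_mulmx mulVmx // det1 mul1r det_diag.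
rewrite (bigD1 i0) //= !mxE l0 !eqxx mulr1 add0r; congr (_ * _).
by apply: eq_bigr => i ii0; rewrite !mxE eqxx (negPf ii0) mulr0 addr0.
Qed.

(** Both sides are the trace of the Laplacian, the sum of the degrees. *)
Lemma sum_spectrum : \sum_(i | i != i0) l 0 i = (2 * #|edges G|)%:R.
Proof.
have [Pu PL _ l0] := PlP.
transitivity (\sum_i l 0 i); first by rewrite [RHS](bigD1 i0) //= l0 add0r.
rewrite -mxtrace_diag -[diag_mx l](mulmxK Pu) -PL mxtrace_mulC mulKmx //.
rewrite -sum_card_sedge natr_sum [RHS](reindex e) /=; last exact: onW_bij.
by apply: eq_bigr => i _; rewrite mxE eqxx mul1r sedge_irrefl subr0.
Qed.

(* Rayleigh quotient: [l i * |x|^2] is half of the sum of [|x a - x b|^2] over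
   ordered pairs of adjacent vertices. *)
Lemma spectrum_ge0 i : 0 <= l 0 i.
Proof.
have [Pu PL _ _] := PlP; pose x a := P i a.
pose adj a b : C := (sedge (e a) (e b))%:R.
have xE a : l 0 i * x a = \sum_b adj a b * (x a - x b).
  have /matrixP/(_ i a) := PL; rewrite mul_diag_mx [RHS]mxE => <-.
  rewrite mxE; under [RHS]eq_bigr do rewrite mulrBr.
  under [LHS]eq_bigr do rewrite mxE mulrBr.
  rewrite !sumrB -mulr_suml sum_sedge //; congr (_ - _).
    rewrite (bigD1 a) //= eqxx mul1r mulrC big1 ?addr0 // => b ba.
    by rewrite (negPf ba) mul0r mulr0.
  by apply: eq_bigr => b _; rewrite mulrC /adj sedge_sym.
have lx : l 0 i * (\sum_a `|x a| ^+ 2) *+ 2 =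
    \sum_a \sum_b adj a b * `|x a - x b| ^+ 2.
  have S1 : l 0 i * (\sum_a `|x a| ^+ 2) =
      \sum_a \sum_b adj a b * (x a - x b) * (x a)^*.
    rewrite mulr_sumr; apply: eq_bigr => a _.
    by rewrite normCK mulrA xE mulr_suml.
  (* Swapping [a] and [b] in one of the two copies and adding turns the factor [(x a)^*] into
     [(x a - x b)^*]. *)
  rewrite mulr2n {2}S1 exchange_big /= S1 -big_split /=; apply: eq_bigr => a _.
  rewrite -big_split /=; apply: eq_bigr => b _.
  rewrite normCK rmorphB /= /adj (sedge_sym (e b)) -!mulrA -mulrDr.
  by congr (_ * _); rewrite [RHS]mulrBr -[x b - x a]opprB mulNr.
(* A row of an invertible matrix is nonzero. *)
have x0 : 0 < \sum_a `|x a| ^+ 2.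
  rewrite lt_def sumr_ge0 ?andbT => [|a _]; last exact: exprn_ge0.
  apply/negP=> /eqP/psumr_eq0P x0.
  have: row i P *m invmx P != 0.
    rewrite -row_mul mulmxV // row1; apply/eqP=> /rowP/(_ i).
    by rewrite !mxE !eqxx; apply/eqP; rewrite oner_eq0.
  suff -> : row i P = 0 by rewrite mul0mx eqxx.
  apply/rowP=> a; rewrite !mxE; apply/eqP; rewrite -normr_eq0 -sqrf_eq0 x0 //.
  by move=> b _; apply: exprn_ge0.
rewrite -(pmulr_lge0 _ x0) -(pmulrn_lge0 _ (isT : (0 < 2)%N)) lx.
by apply: sumr_ge0 => a _; apply: sumr_ge0 => b _; rewrite mulr_ge0 ?ler0n ?exprn_ge0.
Qed.

(** The Laplacian is here [n] times the identity minus the all-ones matrix. *)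
Lemma complete_spectrum :
    (forall x y : G, x != y -> sedge x y) ->
  forall i, i != i0 -> l 0 i = n%:R.
Proof.
move=> Gc i ii0; have [Pu PL PJ _] := PlP; have e_inj := bij_inj e_bij.
have degE a : \sum_b (sedge (e a) (e b))%:R = n%:R - 1 :> C.
  rewrite (bigD1 a) //= sedge_irrefl add0r.
  rewrite (eq_bigr (fun=> 1)) => [|b ba]; last first.
    by rewrite Gc // (inj_eq e_inj) eq_sym.
  rewrite -[n%:R](_ : \sum_(b < n) 1 = _); last by rewrite sumr_const card_ord.
  by rewrite [in RHS](bigD1 a) //= addrC addrK.
have LE : laplacian C e = n%:R%:M - const_mx 1.
  apply/matrixP=> a b; rewrite !mxE -sum_sedge // degE.
  have [->|ab] := eqVneq a b; first by rewrite sedge_irrefl mul1r subr0 mulr1n.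
  by rewrite Gc ?(inj_eq e_inj) // mul0r mulr0n.
have : diag_mx l = n%:R%:M - diag_mx (n%:R *: delta_mx 0 i0).
  apply: (can_inj (mulmxK Pu)); rewrite -PL LE mulmxBr mulmxBl -PJ.
  by rewrite scalar_mxC.
by move/matrixP/(_ i i); rewrite !mxE !eqxx (negPf ii0) mulr0 !mulr1n subr0.
Qed.

(** The Laplacian must be [c] times the identity minus [c / n] times the all-ones matrix, the factor
    cancelling [c] at [i0]. Its off-diagonal entries are then nonzero, so all distinct vertices are
    adjacent. *)
Lemma spectrum_complete c :
    c != 0 -> (forall i, i != i0 -> l 0 i = c) ->
  forall x y : G, x != y -> sedge x y.
Proof.
move=> c0 lc x y; have [e' eK e'K] := e_bij; have [Pu PL PJ l0] := PlP.
rewrite -[x]e'K -[y]e'K (inj_eq (can_inj eK)) => ab.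
have nz : n%:R != 0 :> C by rewrite pnatr_eq0 -lt0n.
have lE : diag_mx l = c%:M - (c / n%:R) *: diag_mx (n%:R *: delta_mx 0 i0).
  apply/matrixP=> i j; rewrite !mxE; have [_|_] := eqVneq i j; last first.
    by rewrite !mulr0n mulr0 subr0.
  rewrite !mulr1n eqxx; have [->|/lc ->] := eqVneq i i0.
    by rewrite l0 mulr1 divfK // subrr.
  by rewrite !mulr0 subr0.
have LE : laplacian C e = c%:M - (c / n%:R) *: const_mx 1.
  apply: (can_inj (mulKmx Pu)); rewrite PL lE mulmxBl mulmxBr scalar_mxC.
  by rewrite -scalemxAl -PJ scalemxAr.
have /matrixP/(_ (e' x) (e' y)) := LE; rewrite !mxE (negPf ab).
rewrite mul0r sub0r mulr0n sub0r mulr1; case: sedge => // /eqP.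
by rewrite eqr_opp eq_sym mulf_eq0 invr_eq0 (negPf c0) (negPf nz).
Qed.

End Properties.

End Spectrum.

(** * Cartesian products *)

Section CartesianSpectrum.
Variables (C : numClosedFieldType) (G1 G2 : sgraph) (n1 n2 : nat).
Variables (e1 : 'I_n1 -> G1) (e2 : 'I_n2 -> G2).
Hypotheses (e1_bij : bijective e1) (e2_bij : bijective e2).

(** Lists the pairs in the index order of the Kronecker product [*t]. *)
Definition cart_enum (k : 'I_(n1 * n2)) : cart_prod G1 G2 :=
  (e1 (mxtens_unindex k).1, e2 (mxtens_unindex k).2).

Lemma cart_enum_bij : bijective cart_enum.
Proof.
have [f1 e1K f1K] := e1_bij; have [f2 e2K f2K] := e2_bij.
exists (fun x : cart_prod G1 G2 => mxtens_index (f1 x.1, f2 x.2)) => [k|[x y]].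
  by rewrite /cart_enum /= e1K e2K -[RHS]mxtens_unindexK.
by rewrite /cart_enum mxtens_indexK /= f1K f2K.
Qed.

(** Degrees add, and without loops the two ways of being adjacent exclude each other, so the
    adjacency indicator is a sum as well. *)
Lemma laplacian_cart_prod : laplacian C cart_enum =
  laplacian C e1 *t 1%:M + 1%:M *t laplacian C e2.
Proof.
have e1_inj := bij_inj e1_bij; have e2_inj := bij_inj e2_bij.
have adjE i1 i2 j1 j2 : (@sedge (cart_prod G1 G2) (e1 i1, e2 i2) (e1 j1, e2 j2))%:R =
    (sedge (e1 i1) (e1 j1))%:R * (i2 == j2)%:R +
    (i1 == j1)%:R * (sedge (e2 i2) (e2 j2))%:R :> C.
  transitivity ((cart_rel (e1 i1, e2 i2) (e1 j1, e2 j2))%:R : C) => //.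
  rewrite /cart_rel /= (inj_eq e1_inj) (inj_eq e2_inj).
  have [->|_] := eqVneq i1 j1; have [->|_] := eqVneq i2 j2;
  by rewrite ?sedge_irrefl /= ?(mul0r, mul1r, mulr0, mulr1, add0r, addr0, orbF).
apply/matrixP=> i j; case: (mxtens_indexP i) => i1 i2.
case: (mxtens_indexP j) => j1 j2; rewrite [RHS]mxE !tensmxE !mxE.
rewrite -(sum_sedge C cart_enum_bij) (can_eq (@mxtens_indexK _ _)) xpair_eqE.
rewrite /cart_enum !mxtens_indexK /= adjE.
have -> : \sum_k (@sedge (cart_prod G1 G2) (e1 i1, e2 i2) (cart_enum k))%:R =
    #|[pred y | sedge (e1 i1) y]|%:R + #|[pred y | sedge (e2 i2) y]|%:R :> C.
  rewrite (reindex (@mxtens_index n1 n2)) /=; last first.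
    by exists (@mxtens_unindex n1 n2) => k _; rewrite (mxtens_indexK, mxtens_unindexK).
  rewrite (eq_bigr (fun p => (sedge (e1 i1) (e1 p.1))%:R * (i2 == p.2)%:R +
      (i1 == p.1)%:R * (sedge (e2 i2) (e2 p.2))%:R)) => [|[a b] _]; last first.
    by rewrite /cart_enum mxtens_indexK adjE.
  rewrite big_split /=.
  rewrite -(pair_bigA _ (fun a b => (sedge (e1 i1) (e1 a))%:R * (i2 == b)%:R)) /=.
  rewrite -(pair_bigA _ (fun a b => (i1 == a)%:R * (sedge (e2 i2) (e2 b))%:R)) /=.
  rewrite -!(sum_sedge C) //; congr (_ + _).
    apply: eq_bigr => a _; rewrite (bigD1 i2) //= eqxx mulr1 big1 ?addr0 //.
    by move=> b bi; rewrite eq_sym (negPf bi) mulr0.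
  rewrite (bigD1 i1) //= [X in _ + X]big1 ?addr0 => [|a ai].
    by apply: eq_bigr => b _; rewrite eqxx mul1r.
  by rewrite big1 // => b _; rewrite eq_sym (negPf ai) mul0r.
rewrite -mulnb natrM mulrDr mulrBl mulrBr opprD addrACA [in RHS]mulrA.
by rewrite [_ * #|_|%:R * (i2 == j2)%:R]mulrAC.
Qed.

(** Kronecker products of eigenvectors are eigenvectors, and the all-ones matrix is itself a
    Kronecker product of all-ones matrices. *)
Lemma cart_prod_spectrum P1 l1 i1 P2 l2 i2 :
    laplacian_spectrum (C := C) e1 P1 l1 i1 ->
    laplacian_spectrum e2 P2 l2 i2 ->
  laplacian_spectrum cart_enum (P1 *t P2)
    (\row_k (l1 0 (mxtens_unindex k).1 + l2 0 (mxtens_unindex k).2))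
    (mxtens_index (i1, i2)).
Proof.
move=> [P1u P1L P1J l10] [P2u P2L P2J l20].
have n0 n (i : 'I_n) : n != 0%N by rewrite -lt0n (leq_ltn_trans _ (ltn_ord i)).
split.
- exact: tensmx_unit (n0 _ i1) (n0 _ i2) P1u P2u.
- have -> : diag_mx (\row_k (l1 0 (mxtens_unindex k).1 + l2 0 (mxtens_unindex k).2)) =
      diag_mx l1 *t 1%:M + 1%:M *t diag_mx l2.
    apply/matrixP=> i j; case: (mxtens_indexP i) => a b.
    case: (mxtens_indexP j) => c d; rewrite [RHS]mxE !tensmxE !mxE.
    rewrite (can_eq (@mxtens_indexK _ _)) xpair_eqE mxtens_indexK /=.
    by case: (a == c); case: (b == d); rewrite ?(mulr1n, mulr0n, mulr0, mul0r, mulr1, mul1r, addr0).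
  rewrite laplacian_cart_prod mulmxDr mulmxDl !tensmx_mul P1L P2L.
  by rewrite !mulmx1 !mul1mx.
- have -> : const_mx 1 = const_mx 1 *t const_mx 1 :> 'M[C]_(n1 * n2).
    by apply/matrixP=> i j; rewrite !mxE mulr1.
  rewrite tensmx_mul P1J P2J -tensmx_mul; congr (_ *m _).
  apply/matrixP=> i j; case: (mxtens_indexP i) => a b.
  case: (mxtens_indexP j) => c d; rewrite tensmxE !mxE.
  rewrite !(can_eq (@mxtens_indexK _ _)) !xpair_eqE natrM.
  case: (a == c); case: (b == d); case: (a == i1); case: (b == i2);
    by rewrite ?(mulr1n, mulr0n, mulr0, mul0r, mulr1, mul1r).
- by rewrite mxE mxtens_indexK /= l10 l20 addr0.
Qed.

(** Among the pairs other than [(i1, i2)], those with second index [i2] contribute the product for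
    [G1], those with first index [i1] the product for [G2], and the rest remain. *)
Lemma tau_cart_prod P1 l1 i1 P2 l2 i2 :
    laplacian_spectrum (C := C) e1 P1 l1 i1 ->
    laplacian_spectrum e2 P2 l2 i2 ->
  (tau (cart_prod G1 G2))%:R = (tau G1)%:R * (tau G2)%:R *
    \prod_(p : 'I_n1 * 'I_n2 | (p.1 != i1) && (p.2 != i2)) (l1 0 p.1 + l2 0 p.2).
Proof.
move=> sp1 sp2.
have n0 n (i : 'I_n) : n%:R != 0 :> C.
  by rewrite pnatr_eq0 -lt0n (leq_ltn_trans _ (ltn_ord i)).
have [[_ _ _ l10] [_ _ _ l20]] := (sp1, sp2).
apply: (mulfI (mulf_neq0 (n0 _ i1) (n0 _ i2))).
rewrite -[n1%:R * n2%:R]natrM (tau_spectrum cart_enum_bij (cart_prod_spectrum sp1 sp2)) natrM.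
rewrite mulrA [n1%:R * _ * _]mulrACA (tau_spectrum e1_bij sp1) (tau_spectrum e2_bij sp2).
rewrite (reindex (@mxtens_index n1 n2)); last first.
  by exists (@mxtens_unindex n1 n2) => k _; rewrite (mxtens_indexK, mxtens_unindexK).
rewrite (eq_big (fun p => p != (i1, i2)) (fun p => l1 0 p.1 + l2 0 p.2)); first last.
- by move=> p _; rewrite mxE mxtens_indexK.
- by move=> p; rewrite (can_eq (@mxtens_indexK _ _)).
rewrite (bigID (fun p => p.1 == i1)) /= mulrC (bigID (fun p => p.2 == i2)) /=.
rewrite mulrAC; congr (_ * _ * _).
- rewrite (eq_bigl (fun p => (p.1 != i1) && (p.2 == i2))) => [|[a b]]; last first.
    by rewrite xpair_eqE /=; case: (a == i1); case: (b == i2).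
  rewrite -(pair_big (fun a => a != i1) (pred1 i2) (fun a b => l1 0 a + l2 0 b)) /=.
  by apply: eq_bigr => a _; rewrite big_pred1_eq l20 addr0.
- rewrite (eq_bigl (fun p => (p.1 == i1) && (p.2 != i2))) => [|[a b]]; last first.
    by rewrite xpair_eqE /=; case: (a == i1); case: (b == i2).
  rewrite -(pair_big (pred1 i1) (fun b => b != i2) (fun a b => l1 0 a + l2 0 b)) /=.
  by rewrite big_pred1_eq; apply: eq_bigr => b _; rewrite l10 add0r.
- apply: eq_bigl => -[a b]; rewrite xpair_eqE /=.
  by case: (a == i1); case: (b == i2).
Qed.

End CartesianSpectrum.

(** * The bound and its equality case *)

(** Formulated over [algC], where the eigenvalues live, with completeness as adjacency of all
    distinct vertices, which is what the spectrum detects. *)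
Lemma tau_cart_prod_bound (G1 G2 : sgraph) (n1 n2 : nat) :
    n1 = #|G1| -> n2 = #|G2| -> (2 <= n1)%N -> (2 <= n2)%N ->
  let lhs : algC := (tau (cart_prod G1 G2))%:R in
  let rhs : algC := (tau G1)%:R * (tau G2)%:R *
    (2 * #|edges G1|%:R / (n1%:R - 1) + 2 * #|edges G2|%:R / (n2%:R - 1))
      ^+ ((n1 - 1) * (n2 - 1)) in
  lhs <= rhs /\
  (lhs = rhs <->
     [\/ ~ connected G1, ~ connected G2
       | (forall x y : G1, x != y -> sedge x y) /\
         (forall x y : G2, x != y -> sedge x y)]).
Proof.
move=> hn1 hn2 n1_ge2 n2_ge2.
have [e1 e1b] : exists e : 'I_n1 -> G1, bijective e.
  by rewrite hn1; exists enum_val; apply: enum_val_bij.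
have [e2 e2b] : exists e : 'I_n2 -> G2, bijective e.
  by rewrite hn2; exists enum_val; apply: enum_val_bij.
have [P1 [l1 [i1 sp1]]] := exists_laplacian_spectrum algC e1b (ltnW n1_ge2).
have [P2 [l2 [i2 sp2]]] := exists_laplacian_spectrum algC e2b (ltnW n2_ge2).
pose A := [pred p : 'I_n1 * 'I_n2 | (p.1 != i1) && (p.2 != i2)].
pose E (p : 'I_n1 * 'I_n2) := l1 0 p.1 + l2 0 p.2.
have cC n (i : 'I_n) : #|[pred k | k != i]| = (n - 1)%N.
  by rewrite (eq_card (B := predC1 i)) // cardC1 card_ord subn1.
have cA : #|A| = ((n1 - 1) * (n2 - 1))%N by rewrite -(cC _ i1) -(cC _ i2) -cardX.
have nzB n : (2 <= n)%N -> n%:R - 1 != 0 :> algC.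
  by move=> n_ge2; rewrite subr_eq0 pnatr_eq1; case: n n_ge2 => [|[]].
have natB n : (2 <= n)%N -> (n - 1)%:R = n%:R - 1 :> algC.
  by move=> n_ge2; rewrite natrB // ltnW.
(* Each [l1] value occurs in [n2 - 1] pairs and each [l2] value in [n1 - 1], so the trace formulas
   make the mean of [E] the bracket of the bound. *)
have sumA : (\sum_(p in A) E p) / #|A|%:R =
    2 * #|edges G1|%:R / (n1%:R - 1) + 2 * #|edges G2|%:R / (n2%:R - 1).
  rewrite cA natrM !natB // big_split /=.
  rewrite -(pair_big (fun a => a != i1) (fun b => b != i2) (fun a b => l1 0 a)) /=.
  rewrite -(pair_big (fun a => a != i1) (fun b => b != i2) (fun a b => l2 0 b)) /=.
  under eq_bigr do rewrite sumr_const (cC _ i2).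
  rewrite sumr_const cC (sum_spectrum e2b sp2) sumrMnl (sum_spectrum e1b sp1).
  rewrite -[_ *+ (n2 - 1)]mulr_natr -[_ *+ (n1 - 1)]mulr_natr !natB // !natrM.
  rewrite mulrDl invfM [X in X + _]mulrACA divff ?nzB // mulr1; congr (_ + _).
  by rewrite [_^-1 * _^-1]mulrC mulrACA divff ?nzB // mulr1.
have E_ge0 : {in A, forall p, 0 <= E p}.
  by move=> p _; rewrite addr_ge0 ?(spectrum_ge0 e1b sp1) ?(spectrum_ge0 e2b sp2).
have [] := leif_AGM E_ge0; rewrite sumA cA => AGM AGMeq lhs rhs.
have lhsE : lhs = (tau G1)%:R * (tau G2)%:R * \prod_(p in A) E p.
  exact: (tau_cart_prod e1b e2b sp1 sp2).
split; first by rewrite lhsE ler_wpM2l // mulr_ge0 ?ler0n.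
(* If a factor has no spanning tree, it is disconnected and both sides are [0]. Otherwise the common
   factor can be cancelled. *)
have [t1|t1] := posnP (tau G1).
  rewrite lhsE /rhs t1 !mul0r; split=> // _; apply: Or31.
  by rewrite -tau_gt0 ?t1 // -hn1 ltnW.
have [t2|t2] := posnP (tau G2).
  rewrite lhsE /rhs t2 mulr0 !mul0r; split=> // _; apply: Or32.
  by rewrite -tau_gt0 ?t2 // -hn2 ltnW.
have tnz : (tau G1)%:R * (tau G2)%:R != 0 :> algC.
  by rewrite -natrM pnatr_eq0 -lt0n muln_gt0 t1.
have other n (i : 'I_n) : (2 <= n)%N -> exists k, k != i.
  move=> n_ge2; have /card_gt0P[k] : (0 < #|[pred k | k != i]|)%N.
    by rewrite cC subn_gt0.
  by rewrite inE; exists k.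
(* Holding one coordinate at [k1] or [k2] splits equality of all sums [E] into equality of the [l1]
   values and of the [l2] values. *)
have [k1 k1i] := other _ i1 n1_ge2; have [k2 k2i] := other _ i2 n2_ge2.
(* The product of these eigenvalues is [n] times [tau G], which is nonzero. *)
have lnz (G : sgraph) n (e : 'I_n -> G) P l i k : bijective e ->
    laplacian_spectrum (C := algC) e P l i -> (2 <= n)%N -> (0 < tau G)%N ->
    k != i -> l 0 k != 0.
  move=> eb sp n_ge2 t ki; have := tau_spectrum eb sp.
  rewrite (bigD1 k) //= -natrM => /eqP; apply: contraTneq => ->.
  by rewrite mul0r pnatr_eq0 muln_eq0 negb_or -!lt0n t ltnW.
split=> [eq_lr|].
  have /forall_inP allE : [forall i in A, forall j in A, E i == E j].
    by rewrite -AGMeq -(inj_eq (mulfI tnz)) -lhsE eq_lr.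
  have EE a b c d : a != i1 -> c != i1 -> b != i2 -> d != i2 ->
      l1 0 a + l2 0 b = l1 0 c + l2 0 d.
    move=> ai ci bi di; apply/eqP.
    have abA : (a, b) \in A by rewrite inE ai bi.
    have cdA : (c, d) \in A by rewrite inE ci di.
    by have /forall_inP/(_ _ cdA) := allE _ abA.
  apply: Or33; split.
    apply: (spectrum_complete e1b sp1 (c := l1 0 k1)); first exact: lnz e1b sp1 _ _ _.
    by move=> i ii; apply: (addIr (l2 0 k2)); apply: EE.
  apply: (spectrum_complete e2b sp2 (c := l2 0 k2)); first exact: lnz e2b sp2 _ _ _.
  by move=> i ii; apply: (addrI (l1 0 k1)); apply: EE.
case=> [|| [G1c G2c]]; rewrite -?tau_gt0 -?hn1 -?hn2 ?(ltnW n1_ge2) ?(ltnW n2_ge2) //.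
rewrite lhsE; congr (_ * _); apply/eqP; rewrite AGMeq.
apply/forall_inP=> p; rewrite inE => /andP[p1 p2]; apply/forall_inP=> q.
rewrite inE => /andP[q1 q2]; apply/eqP; rewrite /E.
rewrite !(complete_spectrum e1b sp1 G1c) //.
by rewrite !(complete_spectrum e2b sp2 G2c).
Qed.

Lemma sg_iso_completeP (G : sgraph) n : n = #|G| ->
  sg_iso G (complete_graph n) <-> forall x y : G, x != y -> sedge x y.
Proof.
move=> ->; split=> [[f /bij_inj f_inj fE] x y xy|Gc].
  by rewrite -fE /= /complete_rel /= (inj_eq f_inj).
exists enum_rank; first exact: enum_rank_bij.
move=> x y; rewrite /= /complete_rel /= (inj_eq enum_rank_inj).
by have [->|/Gc ->] := eqVneq x y; rewrite ?sedge_irrefl.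
Qed.

Theorem theorem2 (G1 G2 : sgraph) (n1 n2 m1 m2 : nat)
    (hn1 : n1 = #|G1|) (hn2 : n2 = #|G2|)
    (hm1 : m1 = #|edges G1|) (hm2 : m2 = #|edges G2|)
    (n1_ge2 : (2 <= n1)%N) (n2_ge2 : (2 <= n2)%N) :
  let lhs : rat := (tau (cart_prod G1 G2))%:R in
  let rhs : rat := (tau G1)%:R * (tau G2)%:R *
    (2 * m1%:R / (n1%:R - 1) + 2 * m2%:R / (n2%:R - 1))
      ^+ ((n1 - 1) * (n2 - 1)) in
  lhs <= rhs /\
  (lhs = rhs <->
     [\/ ~ connected G1, ~ connected G2
       | sg_iso G1 (complete_graph n1) /\ sg_iso G2 (complete_graph n2)]).
Proof.
move=> lhs rhs; have [] := tau_cart_prod_bound hn1 hn2 n1_ge2 n2_ge2.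
set lhsC : algC := _%:R; set rhsC : algC := _ * _ => le_lr eq_lr.
(* The embedding of [rat] into [algC] carries both sides over and reflects order and equality. *)
have lE : ratr lhs = lhsC by rewrite ratr_nat.
have rE : ratr rhs = rhsC.
  rewrite /rhs hm1 hm2 !rmorphM /= !ratr_nat rmorphXn rmorphD /= !fmorph_div.
  by rewrite !rmorphM !rmorphB /= !ratr_nat rmorph1.
split; first by rewrite -(ler_rat algC) lE rE.
have [iso1 iso2] := (sg_iso_completeP hn1, sg_iso_completeP hn2).
split=> [lr|cond].
  have /eq_lr[c|c|[/iso1 c1 /iso2 c2]] : lhsC = rhsC by rewrite -lE -rE lr.
  - exact: Or31.
  - exact: Or32.
  - exact: Or33.
apply: (fmorph_inj (@ratr algC)); rewrite /= lE rE; apply/eq_lr.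
case: cond => [c|c|[/iso1 c1 /iso2 c2]]; [exact: Or31 | exact: Or32 | exact: Or33].
Qed.
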